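(* Let $N$ be a unitarily invariant norm on $M_n(\mathbb{C})$ and let $A,X\in M_n(\mathbb{C})$ with $A$ positive definite. Then for every $t\in[0,1]$, $$w_N(A^tXA^t)\le \big(w_N(AXA)\big)^{t}\,\big(w_N(X)\big)^{1-t},$$ and $$2\,w_N\big(A^{1/2}XA^{1/2}\big)\le w_N\big(A^tXA^{1-t}+A^{1-t}XA^{t}\big)\le w_N(AX+XA).$$
   Context: For a norm $N$ on $M_n(\mathbb{C})$ (the $n\times n$ complex matrices), the generalized numerical radius of $Y\in M_n(\mathbb{C})$ is $w_N(Y)=\sup_{\theta\in\mathbb{R}}N(\mathrm{Re}(e^{i\theta}Y))$, where $\mathrm{Re}(Z)=\frac12(Z+Z^* )$. The norm $N$ is unitarily invariant if $N(UYV)=N(Y)$ for all $Y\in M_n(\mathbb{C})$ and all unitary $U,V\in M_n(\mathbb{C})$. For a positive definite (Hermitian) matrix $A$ and $t\in\mathbb{R}$, $A^t$ is defined by the functional calculus. *)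

(* Defs.v *)
From mathcomp Require Import all_boot all_order all_algebra.
From mathcomp Require Import complex.
From mathcomp Require Import all_classical all_reals all_analysis.

Set Implicit Arguments.
Unset Strict Implicit.
Unset Printing Implicit Defensive.

Import Order.TTheory GRing.Theory Num.Theory.
Local Open Scope classical_set_scope.
Local Open Scope sesquilinear_scope.
Local Open Scope ring_scope.

(* [ComplexField.Normc.normc] is the R-valued
   modulus, and [M ^t*] is the conjugate transpose. *)

Definition is_mxnorm (R : realType) (n : nat) (N : 'M[R[i]]_n -> R) : Prop :=
  [/\ forall Y, 0 <= N Y,
      forall Y, N Y = 0 <-> Y = 0,
      forall (c : R[i]) Y, N (c *: Y) = ComplexField.Normc.normc c * N Y &
      forall Y Z, N (Y + Z) <= N Y + N Z].

Definition unitarily_invariant (R : realType) (n : nat)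
    (N : 'M[R[i]]_n -> R) : Prop :=
  forall Y U V : 'M[R[i]]_n, U \is unitarymx -> V \is unitarymx ->
    N (U *m Y *m V) = N Y.

Definition posdefmx (R : realType) (n : nat) (A : 'M[R[i]]_n) : Prop :=
  A \is hermsymmx /\
  forall v : 'cV[R[i]]_n, v != 0 -> 0 < (v ^t* *m A *m v) 0 0.

(* Functional calculus for x |-> x `^ t: by [orthomx_spectralP], a normal A
   equals invmx P *m diag_mx d *m P with P := spectralmx A unitary and
   d := spectral_diag A.  Only meaningful when A is positive definite, in which
   case the entries of d are positive reals and [complex.Re] loses nothing. *)
Definition mxpowR (R : realType) (n : nat) (A : 'M[R[i]]_n) (t : R) :
    'M[R[i]]_n :=
  invmx (spectralmx A)
  *m diag_mx (map_mx (fun z : R[i] => real_complex R (complex.Re z `^ t))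
                     (spectral_diag A))
  *m spectralmx A.

Definition mxRe (R : realType) (n : nat) (Z : 'M[R[i]]_n) : 'M[R[i]]_n :=
  2^-1 *: (Z + Z ^t*).

Definition cexpi (R : realType) (theta : R) : R[i] :=
  Complex (cos theta) (sin theta).

(* The set is nonempty and, when N is a norm, bounded above by
   (N Y + N (Y ^t* )) / 2, so [sup] is a genuine supremum. *)
Definition gnumradius (R : realType) (n : nat) (N : 'M[R[i]]_n -> R)
    (Y : 'M[R[i]]_n) : R :=
  sup [set N (mxRe (cexpi theta *: Y)) | theta in [set: R]].

(* Main.v *)
(* In an eigenbasis of [A] every map in the statement multiplies the entries of a
   matrix by a kernel, a function of [x i j = l i + l j] or [x i j = l i - l j],
   where the [l i] are the logarithms of the eigenvalues.  Unitary invariance says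
   that the multipliers [exp (i tau x)] are isometries for all real [tau], hence
   [1 + i c x] does not decrease the norm.  Now [cosh] is the limit of the
   polynomials [((1 + y / m) ^ m + (1 - y / m) ^ m) / 2], whose roots are purely
   imaginary, so these are products of factors [1 + i c y] and the norm of
   [cosh (a x) Z] increases with [a >= 0].  With [x i j = l i - l j] this is the
   Heinz inequality.  With [x i j = l i + l j] it gives midpoint convexity of
   [t |-> N (A^t H A^t)], and rescaling [A] turns the resulting maximum principle
   into log-convexity.  Finally [Re] commutes with the maps involved, so the bounds
   for [H = Re (exp (i theta) X)] carry over to the numerical radius. *)
Require Import Defs.
From mathcomp Require Import all_boot all_order all_algebra.
From mathcomp Require Import complex.
From mathcomp Require Import all_classical all_reals all_analysis.
From mathcomp Require Import ring lra.

Set Implicit Arguments.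
Unset Strict Implicit.
Unset Printing Implicit Defensive.

Import Order.TTheory GRing.Theory Num.Theory.
Import numFieldNormedType.Exports.
Local Open Scope sesquilinear_scope.
Local Open Scope ring_scope.

Local Notation normc := ComplexField.Normc.normc.

Lemma normc_le_ReIm (R : realType) (a b : R) : normc (Complex a b) <= `|a| + `|b|.
Proof.
rewrite /= -[leRHS]ger0_norm ?addr_ge0// -sqrtr_sqr ler_wsqrtr//.
rewrite -(real_normK (num_real a)) -(real_normK (num_real b)) sqrrD.
by rewrite lerD2r lerDl mulrn_wge0// mulr_ge0.
Qed.

Lemma normc_real (R : realType) (a : R) : normc (real_complex R a) = `|a|.
Proof. by rewrite /= expr0n addr0 sqrtr_sqr. Qed.

Lemma normc_nneg (R : realType) (z : R[i]) : 0 <= normc z.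
Proof. by case: z => a b; apply: sqrtr_ge0. Qed.

Lemma normc_ger0 (R : realType) (a : R) : 0 <= a -> normc (real_complex R a) = a.
Proof. by move=> a0; rewrite normc_real ger0_norm. Qed.

Lemma is_derive_norm_le (R : realType) (f df : R -> R) (K x : R) :
  (forall y : R, is_derive y (1 : R) f (df y)) ->
  (forall y, `|y| <= `|x| -> `|df y| <= K) ->
  `|f x - f 0| <= K * `|x|.
Proof.
move=> fd dK; have cf (a b : R) : {within `[a, b], continuous f}%classic.
  apply: derivable_within_continuous => y _.
  by have := fd y; case.
have [x0|/ltW x0] := leP 0 x.
  have [y] := MVT_segment x0 (fun y _ => fd y) (cf _ _).
  rewrite in_itv/= => /andP[y0 yx] ->; rewrite subr0 normrM ler_wpM2r//.
  by apply: dK; rewrite !ger0_norm.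
have [y] := MVT_segment x0 (fun y _ => fd y) (cf _ _).
rewrite in_itv/= => /andP[y0 yx]; rewrite sub0r distrC => ->.
rewrite normrM normrN ler_wpM2r//.
by apply: dK; rewrite !ler0_norm// lerN2.
Qed.

Lemma cexpi_taylor (R : realType) (x : R) :
  normc (cexpi x - Complex 1 x) <= 2 * x ^+ 2.
Proof.
have dcos y : `|cos y - 1| <= `|y| :> R.
  rewrite -[X in _ - X]cos0 -[leRHS]mul1r.
  apply: (@is_derive_norm_le R cos (fun z => - sin z)) => z _.
  by rewrite normrN ler_norml sin_geN1 sin_le1.
have dsin1 y : `|sin y| <= `|y| :> R.
  rewrite -[X in `|X|]subr0 -[X in _ - X](@sin0 R) -[leRHS]mul1r.
  apply: (@is_derive_norm_le R sin cos) => z _.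
  by rewrite ler_norml cos_geN1 cos_le1.
have dcos2 : `|cos x - 1| <= x ^+ 2.
  rewrite -[X in _ - X]cos0 -real_normK ?num_real// expr2.
  apply: (@is_derive_norm_le R cos (fun z => - sin z)) => z zx.
  by rewrite normrN (le_trans (dsin1 z)).
have dsin : `|sin x - x| <= x ^+ 2.
  have -> : sin x - x = (sin x - x) - (sin 0 - 0) by rewrite sin0 !subr0.
  rewrite -real_normK ?num_real// expr2.
  apply: (@is_derive_norm_le R (fun z => sin z - z) (fun z => cos z - 1)) => z zx.
  exact: le_trans (dcos z) zx.
apply: le_trans (normc_le_ReIm _ _) _.
by rewrite mulr_natl mulr2n lerD.
Qed.

Lemma expr_prod_linear (R : realType) (m : nat) : exists s : seq R, forall y : R,
  real_complex R (((1 + y / m.+1%:R) ^+ m.+1 + (1 - y / m.+1%:R) ^+ m.+1) / 2)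
  = \prod_(c <- s) Complex 1 (c * y).
Proof.
set a : R := m.+1%:R^-1; set ac := real_complex R a.
have a0 : a != 0 by rewrite invr_eq0 pnatr_eq0.
pose P : {poly R[i]} := (1 + ac *: 'X) ^+ m.+1 + (1 - ac *: 'X) ^+ m.+1.
have PE z : P.[z] = (1 + ac * z) ^+ m.+1 + (1 - ac * z) ^+ m.+1 by rewrite /P !hornerE.
have [r Pr] := closed_field_poly_normal P.
have hr z : P.[z] = lead_coef P * \prod_(u <- r) (z - u).
  by rewrite {1}Pr hornerZ horner_prod; congr (_ * _); apply: eq_bigr => u _; rewrite !hornerE.
have P0 : P.[0] = 2 by rewrite PE !mulr0 addr0 subr0 !expr1n.
have rr u : u \in r -> u = Complex 0 (complex.Im u) /\ complex.Im u != 0.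
  move=> ur; have Pu : P.[u] = 0.
    by rewrite hr (big_rem u)//= subrr mul0r mulr0.
  have Re0 : complex.Re u = 0.
    move: Pu; rewrite PE => /eqP; rewrite addr_eq0 => /eqP /(congr1 Num.norm).
    rewrite normrN !normrX => /(pexpIrn (ltn0Sn m)).
    rewrite !nnegrE !normr_ge0 => /(_ isT isT) /(congr1 (fun z => z ^+ 2)).
    rewrite -!add_Re2_Im2 => /complexI.
    case: (u) => p q /=; rewrite !(mul0r, subr0, addr0, add0r) => H.
    have : a * p = 0 by nra.
    by move/eqP; rewrite mulf_eq0 (negPf a0) => /eqP.
  case: (u) Re0 Pu => p q /= -> Pu; split => //.
  apply/eqP => q0; move: Pu; rewrite q0 P0 => /eqP.
  by rewrite pnatr_eq0.
exists [seq (complex.Im u)^-1 | u <- r] => y.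
have -> : real_complex R (((1 + y / m.+1%:R) ^+ m.+1 + (1 - y / m.+1%:R) ^+ m.+1) / 2)
          = P.[real_complex R y] / 2.
  rewrite PE rmorphM/= fmorphV/= rmorph_nat rmorphD !rmorphXn/= rmorphB rmorphD rmorph1.
  by rewrite -/a rmorphM -/ac [ac * _]mulrC.
apply: (mulIf (_ : 2 != 0 :> R[i])); first by rewrite pnatr_eq0.
rewrite divfK ?pnatr_eq0// -P0 !hr mulrCA; congr (_ * _).
rewrite big_map -big_split/=; apply: eq_big_seq => u /rr[].
set q := complex.Im u => -> q0.
apply/eqP; rewrite eq_complex/= !(mul0r, mulr0, subr0, addr0, add0r, oppr0, mul1r) eqxx andbT.
by rewrite -mulNr; apply/eqP; field.
Qed.

Lemma bernoulli_ineq (R : realType) (v : R) (k : nat) :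
  0 <= v <= 1 -> 1 - k%:R * v <= (1 - v) ^+ k.
Proof.
move=> /andP[v0 v1]; elim: k => [|k IH]; first by rewrite mul0r subr0 expr0.
rewrite exprS; apply: le_trans (_ : (1 - v) * (1 - k%:R * v) <= _).
  have : 0 <= k%:R * v ^+ 2 by rewrite mulr_ge0// sqr_ge0.
  by rewrite -natr1 => H; nra.
by rewrite ler_wpM2l// subr_ge0.
Qed.

Lemma expR_approx (R : realType) (y : R) (m : nat) : `|y| <= m.+1%:R ->
  `|(1 + y / m.+1%:R) ^+ m.+1 - expR y| <= expR y * (y ^+ 2 / m.+1%:R).
Proof.
set k : R := m.+1%:R => yk; have k0 : 0 < k by rewrite ltr0n.
set u := y / k; have yu : y = k * u by rewrite mulrC divfK// gt_eqF.
have : `|u| <= 1 by rewrite normrM normfV (gtr0_norm k0) ler_pdivrMr// mul1r.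
rewrite ler_norml => /andP[u1 u2].
have eu := expR_ge1Dx u; have eNu := expR_ge1Dx (- u); have euN := expRxMexpNx_1 u.
have e0 := expR_gt0 u.
have low : expR u * (1 - u ^+ 2) <= 1 + u.
  have : expR u * (1 - u) <= 1 by rewrite -[leRHS]euN ler_pM2l.
  have : 0 <= 1 + u by lra.
  have -> : 1 - u ^+ 2 = (1 - u) * (1 + u) by ring.
  by move=> u0 eu1; rewrite mulrA -[leRHS]mul1r ler_wpM2r.
have eX : expR y = expR u ^+ m.+1 by rewrite yu expRM_natl.
have up : (1 + u) ^+ m.+1 <= expR y.
  by rewrite eX lerXn2r ?nnegrE ?expR_ge0//; lra.
have v0 : 0 <= u ^+ 2 <= 1 by rewrite sqr_ge0/=; nra.
have : expR y * (1 - k * u ^+ 2) <= (1 + u) ^+ m.+1.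
  apply: le_trans (_ : expR y * (1 - u ^+ 2) ^+ m.+1 <= _).
    by rewrite ler_wpM2l ?expR_ge0// bernoulli_ineq.
  rewrite eX -exprMn lerXn2r// nnegrE ?mulr_ge0 ?expR_ge0//; lra.
have -> : y ^+ 2 / k = k * u ^+ 2 by rewrite yu; field; rewrite gt_eqF.
by move=> H; rewrite distrC ger0_norm; lra.
Qed.

Definition cosh (R : realType) (y : R) : R := (expR y + expR (- y)) / 2.

Lemma cosh_approx (R : realType) (B e : R) : 0 < e -> exists m : nat, forall y : R,
  `|y| <= B ->
  `|((1 + y / m.+1%:R) ^+ m.+1 + (1 - y / m.+1%:R) ^+ m.+1) / 2 - cosh y| <= e.
Proof.
move=> e0; pose D := B + expR B * B ^+ 2 / e.
exists (Num.truncn D) => y yB; set m := Num.truncn D.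
have B0 : 0 <= B := le_trans (normr_ge0 y) yB.
have T0 : 0 <= expR B * B ^+ 2 by rewrite mulr_ge0 ?expR_ge0// sqr_ge0.
have T1 : 0 <= expR B * B ^+ 2 / e by rewrite divr_ge0// ltW.
have Dm : D < m.+1%:R := truncnS_gt _.
have Bm : B <= m.+1%:R by rewrite (le_trans _ (ltW Dm))// lerDl.
have Tm : expR B * B ^+ 2 / e <= m.+1%:R by rewrite (le_trans _ (ltW Dm))// lerDr.
have m0 : 0 < m.+1%:R :> R by rewrite ltr0n.
have ap z : `|z| = `|y| -> `|(1 + z / m.+1%:R) ^+ m.+1 - expR z| <= e.
  move=> zy; have zB : `|z| <= B by rewrite zy.
  apply: le_trans (expR_approx _) _; first exact: le_trans zB Bm.
  rewrite mulrA ler_pdivrMr//; apply: le_trans (_ : expR B * B ^+ 2 <= _).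
    rewrite ler_pM ?expR_ge0 ?sqr_ge0//.
      by rewrite ler_expR (le_trans (ler_norm z)).
    by rewrite -real_normK ?num_real// lerXn2r// nnegrE.
  by rewrite [leRHS]mulrC -ler_pdivrMr.
have h1 := ap y erefl; have := ap (- y) (normrN y).
rewrite mulNr /cosh; move: h1; set a := _ ^+ _; set b := _ ^+ _.
by rewrite !ler_norml; lra.
Qed.

Lemma cosh_norm (R : realType) (y : R) : cosh `|y| = cosh y.
Proof.
by case: (ger0P y) => // _; rewrite /cosh opprK addrC.
Qed.

Lemma kernel_bounded (R : realType) (n : nat) (x : 'I_n -> 'I_n -> R) :
  exists2 K, 0 <= K & forall i j, `|x i j| <= K.
Proof.
exists (\sum_i \sum_j `|x i j|) => [|i j].
  by apply: sumr_ge0 => i _; apply: sumr_ge0.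
rewrite (bigD1 i)//= (bigD1 j)//= -addrA lerDl addr_ge0//; first exact: sumr_ge0.
by apply: sumr_ge0 => k _; apply: sumr_ge0.
Qed.

Definition schurmx (R : realType) (n : nat) (m : 'I_n -> 'I_n -> R[i])
    (Z : 'M[R[i]]_n) : 'M[R[i]]_n := \matrix_(i, j) (m i j * Z i j).

Definition isometric_kernel (R : realType) (n : nat) (N : 'M[R[i]]_n -> R)
    (x : 'I_n -> 'I_n -> R) : Prop :=
  forall (tau : R) (Z : 'M[R[i]]_n),
    N (schurmx (fun i j => cexpi (tau * x i j)) Z) = N Z.

Definition entry_bound (R : realType) (n : nat) (N : 'M[R[i]]_n -> R)
    (Z : 'M[R[i]]_n) : R := \sum_i \sum_j normc (Z i j) * N (delta_mx i j).

Lemma entry_bound_ge0 (R : realType) (n : nat) (N : 'M[R[i]]_n -> R) Z :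
  is_mxnorm N -> 0 <= entry_bound N Z.
Proof.
case=> N0 _ _ _; apply: sumr_ge0 => i _; apply: sumr_ge0 => j _.
by rewrite mulr_ge0// normc_nneg.
Qed.

Lemma mxnorm0 (R : realType) (n : nat) (N : 'M[R[i]]_n -> R) :
  is_mxnorm N -> N 0 = 0.
Proof. by case=> _ /(_ 0)[_ ->]. Qed.

Lemma mxnorm_sum (R : realType) (n : nat) (N : 'M[R[i]]_n -> R) (I : finType)
    (F : I -> 'M[R[i]]_n) : is_mxnorm N -> N (\sum_i F i) <= \sum_i N (F i).
Proof.
move=> hN; have [_ _ _ ND] := hN.
elim/big_rec2: _ => [|i y1 y2 _ H]; first by rewrite (mxnorm0 hN).
by rewrite (le_trans (ND _ _))// lerD2l.
Qed.

Lemma mxnorm_le_entry_bound (R : realType) (n : nat) (N : 'M[R[i]]_n -> R) Z :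
  is_mxnorm N -> N Z <= entry_bound N Z.
Proof.
move=> hN; have [_ _ NZ _] := hN.
rewrite {1}(matrix_sum_delta Z) (le_trans (mxnorm_sum _ hN))//.
apply: ler_sum => i _; rewrite (le_trans (mxnorm_sum _ hN))//.
by apply: ler_sum => j _; rewrite NZ.
Qed.

Lemma mxnorm_schurmx_le (R : realType) (n : nat) (N : 'M[R[i]]_n -> R)
    (m : 'I_n -> 'I_n -> R[i]) (e : R) Z : is_mxnorm N ->
  (forall i j, normc (m i j) <= e) -> N (schurmx m Z) <= e * entry_bound N Z.
Proof.
move=> hN me; have [N0 _ _ _] := hN.
rewrite (le_trans (mxnorm_le_entry_bound _ hN))// /entry_bound mulr_sumr.
apply: ler_sum => i _; rewrite mulr_sumr; apply: ler_sum => j _.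
by rewrite mulrA ler_wpM2r// mxE ComplexField.Normc.normcM ler_wpM2r// normc_nneg.
Qed.

Lemma mxnorm_schurmx_perturb (R : realType) (n : nat) (N : 'M[R[i]]_n -> R)
    (f g : 'I_n -> 'I_n -> R[i]) (e : R) Z : is_mxnorm N ->
  (forall i j, normc (f i j - g i j) <= e) ->
  N (schurmx f Z) <= N (schurmx g Z) + e * entry_bound N Z.
Proof.
move=> hN fg; have [_ _ _ ND] := hN.
have -> : schurmx f Z = schurmx g Z + schurmx (fun i j => f i j - g i j) Z.
  by apply/matrixP => i j; rewrite !mxE -mulrDl [g i j + _]addrC subrK.
by rewrite (le_trans (ND _ _))// lerD2l mxnorm_schurmx_le.
Qed.

Lemma schurmx_comp (R : realType) (n : nat) (f g : 'I_n -> 'I_n -> R[i]) Z :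
  schurmx f (schurmx g Z) = schurmx (fun i j => f i j * g i j) Z.
Proof. by apply/matrixP => i j; rewrite !mxE mulrA. Qed.

Lemma eq_schurmx (R : realType) (n : nat) (f g : 'I_n -> 'I_n -> R[i]) Z :
  (forall i j, f i j = g i j) -> schurmx f Z = schurmx g Z.
Proof. by move=> fg; apply/matrixP => i j; rewrite !mxE fg. Qed.

Lemma isometric_kernelZ (R : realType) (n : nat) (N : 'M[R[i]]_n -> R) x (c : R) :
  isometric_kernel N x -> isometric_kernel N (fun i j => c * x i j).
Proof.
by move=> hx tau Z; rewrite -(hx (tau * c) Z); congr N; apply: eq_schurmx => i j; rewrite mulrA.
Qed.

(* [Z - h i x Z] differs from its isometric image [exp (- h i x) Z] by
   [O(h^2)], while [Z] is the combination
   [(1 + h^-1) Z = (1 + i x) Z + h^-1 (Z - h i x Z)]. *)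
Lemma isometric_kernel_le (R : realType) (n : nat) (N : 'M[R[i]]_n -> R) x Z :
  is_mxnorm N -> isometric_kernel N x ->
  N Z <= N (schurmx (fun i j => Complex 1 (x i j)) Z).
Proof.
move=> hN hx; have [N0 _ NZ ND] := hN.
set Y := schurmx _ Z.
have [K K0 xK] := kernel_bounded x.
pose B := 2 * K ^+ 2 * entry_bound N Z.
have B0 : 0 <= B.
  by rewrite !mulr_ge0 ?exprn_ge0 ?entry_bound_ge0.
apply/ler_addgt0Pr => e e0.
pose h := e / (B + 1); have h0 : 0 < h by rewrite divr_gt0//; lra.
have hB : h * B <= e.
  by rewrite /h -mulrA ger_pMr// mulrC ler_pdivrMr; lra.
have step : N (schurmx (fun i j => Complex 1 (- h * x i j)) Z) <= N Z + h ^+ 2 * B.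
  rewrite -[N Z](hx (- h)) /B mulrA [_ * (2 * K ^+ 2)](_ : _ = 2 * (h ^+ 2 * K ^+ 2)); last by ring.
  apply: mxnorm_schurmx_perturb => // i j; rewrite -normcN opprB.
  apply: le_trans (cexpi_taylor _) _.
  rewrite ler_pM2l// exprMn sqrrN ler_pM2l ?exprn_gt0//.
  by rewrite -real_normK ?num_real// lerXn2r// nnegrE.
have split : real_complex R (h + 1) *: Z
    = real_complex R h *: Y + schurmx (fun i j => Complex 1 (- h * x i j)) Z.
  apply/matrixP => i j; rewrite !mxE mulrA -mulrDl; congr (_ * _).
  apply/eqP; rewrite eq_complex/= !(mul0r, mulr0, subr0, addr0, add0r, mulr1).
  by rewrite eqxx/= mulNr subrr.
have := ND (real_complex R h *: Y) (schurmx (fun i j => Complex 1 (- h * x i j)) Z).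
rewrite -split !NZ !normc_ger0; [|lra|lra] => H.
have : h * N Z <= h * (N Y + h * B).
  by rewrite mulrDr mulrA -expr2; lra.
by rewrite ler_pM2l//; lra.
Qed.

Lemma isometric_kernel_mono_linear (R : realType) (n : nat) (N : 'M[R[i]]_n -> R)
    x (a b : R) Z : is_mxnorm N -> isometric_kernel N x -> 0 <= a <= b ->
  N (schurmx (fun i j => Complex 1 (a * x i j)) Z)
  <= N (schurmx (fun i j => Complex 1 (b * x i j)) Z).
Proof.
move=> hN hx /andP[a0 ab]; have [N0 _ NZ ND] := hN.
have [b0|b0] := leP b 0.
  by have -> : a = b by lra.
set Y := schurmx (fun i j => Complex 1 (b * x i j)) Z.
have ZY : N Z <= N Y := isometric_kernel_le Z hN (isometric_kernelZ b hx).
pose th := a / b; have th0 : 0 <= th by rewrite divr_ge0// ltW.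
have th1 : th <= 1 by rewrite ler_pdivrMr// mul1r.
have -> : schurmx (fun i j => Complex 1 (a * x i j)) Z
    = real_complex R th *: Y + real_complex R (1 - th) *: Z.
  apply/matrixP => i j; rewrite !mxE mulrA -mulrDl; congr (_ * _).
  apply/eqP; rewrite eq_complex/= !(mul0r, mulr0, subr0, addr0, add0r, mulr1).
  rewrite [th + _]addrC subrK eqxx/= mulrA divfK// gt_eqF//.
rewrite (le_trans (ND _ _))// !NZ !normc_ger0//; last by lra.
by have := N0 Y; nra.
Qed.

Lemma isometric_kernel_mono_prod (R : realType) (n : nat) (N : 'M[R[i]]_n -> R)
    x (a b : R) (s : seq R) Z : is_mxnorm N -> isometric_kernel N x -> 0 <= a <= b ->
  N (schurmx (fun i j => \prod_(c <- s) Complex 1 (c * (a * x i j))) Z)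
  <= N (schurmx (fun i j => \prod_(c <- s) Complex 1 (c * (b * x i j))) Z).
Proof.
move=> hN hx hab; elim: s Z => [|c s IH] Z.
  rewrite (eq_schurmx (g := fun i j => \prod_(c <- [::]) Complex 1 (c * (b * x i j))))//.
  by move=> i j; rewrite !big_nil.
pose f (e : R) i j := Complex 1 (e * (c * x i j)).
pose g e i j := \prod_(c <- s) Complex 1 (c * (e * x i j)).
have fg e : schurmx (fun i j => \prod_(c <- c :: s) Complex 1 (c * (e * x i j))) Z
    = schurmx (f e) (schurmx (g e) Z).
  by rewrite schurmx_comp; apply: eq_schurmx => i j; rewrite big_cons /f mulrCA.
rewrite !fg.
apply: le_trans (isometric_kernel_mono_linear _ hN (isometric_kernelZ c hx) hab) _.
have comm e : schurmx (f b) (schurmx (g e) Z) = schurmx (g e) (schurmx (f b) Z).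
  by rewrite !schurmx_comp; apply: eq_schurmx => i j; rewrite mulrC.
by rewrite !comm; apply: IH.
Qed.

Lemma isometric_kernel_mono_cosh (R : realType) (n : nat) (N : 'M[R[i]]_n -> R)
    x (a b : R) Z : is_mxnorm N -> isometric_kernel N x -> 0 <= a <= b ->
  N (schurmx (fun i j => real_complex R (cosh (a * x i j))) Z)
  <= N (schurmx (fun i j => real_complex R (cosh (b * x i j))) Z).
Proof.
move=> hN hx hab; have E0 := entry_bound_ge0 Z hN.
have /andP[a0 ab] := hab.
have [K K0 xK] := kernel_bounded x.
apply/ler_addgt0Pr => e e0.
pose e' := e / (2 * (entry_bound N Z + 1)).
have e'0 : 0 < e' by rewrite divr_gt0//; lra.
have e'E : 2 * (e' * entry_bound N Z) <= e.
  rewrite mulrA -mulrA mulrCA /e' -mulrA ger_pMr// mulrC ler_pdivrMr; lra.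
have [m hm] := cosh_approx (b * K) e'0.
have [s hs] := expr_prod_linear R m.
have ap c (y : R) : 0 <= c <= b -> `|y| <= K ->
    normc (real_complex R (cosh (c * y)) - \prod_(d <- s) Complex 1 (d * (c * y))) <= e'.
  move=> /andP[c0 cb] yK; rewrite -hs -rmorphB normc_real distrC; apply: hm.
  by rewrite normrM (ger0_norm c0) ler_pM.
have b0 : 0 <= b := le_trans a0 ab.
apply: le_trans (mxnorm_schurmx_perturb
  (g := fun i j => \prod_(d <- s) Complex 1 (d * (a * x i j))) Z hN _) _.
  by move=> i j; apply: ap.
have := isometric_kernel_mono_prod s Z hN hx hab.
have : N (schurmx (fun i j => \prod_(d <- s) Complex 1 (d * (b * x i j))) Z)
    <= N (schurmx (fun i j => real_complex R (cosh (b * x i j))) Z)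
       + e' * entry_bound N Z.
  apply: mxnorm_schurmx_perturb => // i j; rewrite -normcN opprB.
  by apply: ap; rewrite // b0 lexx.
by lra.
Qed.

Lemma isometric_kernel_midpoint (R : realType) (n : nat) (N : 'M[R[i]]_n -> R)
    x (c d : R) Z : is_mxnorm N -> isometric_kernel N x -> 0 <= d ->
  2 * N (schurmx (fun i j => real_complex R (expR (c * x i j))) Z)
  <= N (schurmx (fun i j => real_complex R (expR ((c + d) * x i j))) Z)
     + N (schurmx (fun i j => real_complex R (expR ((c - d) * x i j))) Z).
Proof.
move=> hN hx d0; have [_ _ NZ ND] := hN.
set W := schurmx _ Z; set Wp := schurmx _ Z; set Wm := schurmx _ Z.
have := @isometric_kernel_mono_cosh R n N x 0 d W hN hx.
rewrite lexx d0 => /(_ isT).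
have -> : schurmx (fun i j => real_complex R (cosh (0 * x i j))) W = W.
  apply/matrixP => i j; rewrite mxE mul0r /cosh oppr0 expR0 -mulr2n -mulr_natr mul1r.
  by rewrite divff ?pnatr_eq0// mul1r.
have -> : schurmx (fun i j => real_complex R (cosh (d * x i j))) W
    = real_complex R 2^-1 *: (Wp + Wm).
  apply/matrixP => i j; rewrite !mxE mulrA -rmorphM -mulrDl mulrA -rmorphD -rmorphM.
  congr (real_complex R _ * _).
  by rewrite /cosh [(c + d) * _]mulrDl [(c - d) * _]mulrBl !expRD; ring.
rewrite NZ normc_ger0 ?invr_ge0// => H.
by have := ND Wp Wm; lra.
Qed.

Lemma isometric_kernel_max (R : realType) (n : nat) (N : 'M[R[i]]_n -> R)
    x (t B : R) Z : is_mxnorm N -> isometric_kernel N x -> 0 <= t <= 1 ->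
  N Z <= B -> N (schurmx (fun i j => real_complex R (expR (x i j))) Z) <= B ->
  N (schurmx (fun i j => real_complex R (expR (t * x i j))) Z) <= B.
Proof.
move=> hN hx ht; pose g s := N (schurmx (fun i j => real_complex R (expR (s * x i j))) Z).
have -> : N Z = g 0.
  by congr N; apply/matrixP => i j; rewrite mxE mul0r expR0 mul1r.
have -> : N (schurmx (fun i j => real_complex R (expR (x i j))) Z) = g 1.
  by congr N; apply: eq_schurmx => i j; rewrite mul1r.
rewrite -/(g t) => g0 g1.
have [K K0 xK] := kernel_bounded x.
pose S := [set g s | s in [set s : R | 0 <= s <= 1]]%classic.
have gS s : 0 <= s <= 1 -> g s <= sup S.
  move=> hs; apply: sup_upper_bound; last by exists s.
  split; first by exists (g s), s.
  exists (expR K * entry_bound N Z) => _ [u /andP[u0 u1] <-].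
  apply: mxnorm_schurmx_le => // i j; rewrite normc_ger0 ?expR_ge0// ler_expR.
  apply: le_trans (ler_norm _) _; rewrite normrM (ger0_norm u0).
  by rewrite (le_trans _ (xK i j))// ler_piMl.
have half s : 0 <= s <= 1 -> g s <= (sup S + B) / 2.
  move=> /andP[s0 s1]; rewrite ler_pdivlMr// mulrC.
  have [s2|s2] := leP (2 * s) 1.
    apply: le_trans (isometric_kernel_midpoint s Z hN hx s0) _.
    rewrite subrr lerD// -/(g _) gS//; lra.
  have d0 : 0 <= 1 - s by lra.
  apply: le_trans (isometric_kernel_midpoint s Z hN hx d0) _.
  rewrite addrC lerD//; first by rewrite -/(g _) gS//; lra.
  by rewrite addrC subrK.
have : sup S <= (sup S + B) / 2.
  apply: ge_sup; first by exists (g t), t.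
  by move=> _ [s hs <-]; apply: half.
by have := half t ht; lra.
Qed.

Lemma cexpiD (R : realType) (a b : R) : cexpi (a + b) = cexpi a * cexpi b.
Proof.
rewrite /cexpi cosD sinD; apply/eqP; rewrite eq_complex/= eqxx/=.
by rewrite addrC.
Qed.

Lemma normc_cexpi (R : realType) (a : R) : normc (cexpi a) = 1.
Proof. by rewrite /= cos2Dsin2 sqrtr1. Qed.

Lemma isometric_kernelDc (R : realType) (n : nat) (N : 'M[R[i]]_n -> R) x (k : R) :
  is_mxnorm N -> isometric_kernel N x -> isometric_kernel N (fun i j => x i j + k).
Proof.
move=> [_ _ NZ _] hx tau Z; rewrite -(hx tau Z).
rewrite -[RHS]mul1r -(normc_cexpi (tau * k)) -NZ; congr N.
by apply/matrixP => i j; rewrite !mxE mulrDr addrC cexpiD mulrA.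
Qed.

Lemma isometric_kernel_three_lines (R : realType) (n : nat) (N : 'M[R[i]]_n -> R)
    x (t : R) Z : is_mxnorm N -> isometric_kernel N x -> 0 <= t <= 1 ->
  N (schurmx (fun i j => real_complex R (expR (t * x i j))) Z)
  <= N (schurmx (fun i j => real_complex R (expR (x i j))) Z) `^ t * N Z `^ (1 - t).
Proof.
move=> hN hx ht; have [N0 Neq0 NZ _] := hN.
set Y := schurmx _ Z; set W := schurmx _ Z.
have [Z0|Z0] := eqVneq Z 0.
  suff -> : Y = 0 by rewrite (mxnorm0 hN) mulr_ge0// powR_ge0.
  by apply/matrixP => i j; rewrite !mxE Z0 mxE mulr0.
have NZ0 : 0 < N Z.
  by rewrite lt_neqAle N0 andbT eq_sym; apply/eqP => /Neq0 /eqP; rewrite (negPf Z0).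
have NW0 : 0 < N W.
  rewrite lt_neqAle N0 andbT eq_sym; apply/eqP => /Neq0 /matrixP W0.
  case/eqP: Z0; apply/matrixP => i j; have /eqP := W0 i j; rewrite !mxE mulf_eq0.
  rewrite (_ : (real_complex R _ == 0) = false) ?orFb; first by move/eqP.
  by rewrite (fmorph_eq0 (real_complex R)) expR_eq0.
pose k := ln (N Z) - ln (N W).
have shift s : schurmx (fun i j => real_complex R (expR (s * (x i j + k)))) Z
    = real_complex R (expR (s * k)) *: schurmx (fun i j => real_complex R (expR (s * x i j))) Z.
  by apply/matrixP => i j; rewrite !mxE mulrA -rmorphM mulrDr addrC expRD.
have := @isometric_kernel_max R n N _ t (N Z) Z hN (isometric_kernelDc k hN hx) ht (lexx _).
rewrite shift NZ normc_ger0 ?expR_ge0// -/Y.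
have -> : N (schurmx (fun i j => real_complex R (expR (x i j + k))) Z) = N Z.
  have -> : schurmx (fun i j => real_complex R (expR (x i j + k))) Z
      = real_complex R (expR k) *: W.
    by apply/matrixP => i j; rewrite !mxE mulrA -rmorphM addrC expRD.
  by rewrite NZ normc_ger0 ?expR_ge0// /k expRB !lnK ?posrE// divfK// gt_eqF.
move=> /(_ (lexx _)); rewrite mulrC -ler_pdivlMr ?expR_gt0// => /le_trans; apply.
rewrite -[X in X / _]lnK ?posrE// -expRN -expRD.
rewrite /powR (gt_eqF NZ0) (gt_eqF NW0) -expRD le_eqVlt; apply/orP; left.
by apply/eqP; congr expR; rewrite /k; ring.
Qed.

Lemma conj_real_complex (R : realType) (a : R) :
  (real_complex R a)^* = real_complex R a.
Proof. by apply: conj_Creal; rewrite complex_real. Qed.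

Lemma adjmxM (R : realType) (m n p : nat) (A : 'M[R[i]]_(m, n)) (B : 'M[R[i]]_(n, p)) :
  (A *m B) ^t* = B ^t* *m A ^t*.
Proof. by rewrite trmx_mul map_mxM. Qed.

Lemma adjmxD (R : realType) (m n : nat) (A B : 'M[R[i]]_(m, n)) :
  (A + B) ^t* = A ^t* + B ^t*.
Proof. by rewrite raddfD/= map_mxD. Qed.

Lemma diag_mx_cexpi_unitary (R : realType) (n : nat) (l : 'I_n -> R) :
  diag_mx (\row_i cexpi (l i)) \is unitarymx.
Proof.
apply/unitarymxP/matrixP => i j; rewrite mul_diag_mx !mxE.
have [->|ij] := eqVneq i j; last first.
  by rewrite mulr0n rmorph0 mulr0.
by rewrite mulr1n -normCK normc_def/= cos2Dsin2 sqrtr1 expr1n.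
Qed.

Lemma isometric_kernel_add (R : realType) (n : nat) (N : 'M[R[i]]_n -> R)
    (l m : 'I_n -> R) :
  unitarily_invariant N -> isometric_kernel N (fun i j => l i + m j).
Proof.
move=> hNU tau Z.
rewrite -(hNU Z _ _ (diag_mx_cexpi_unitary (fun i => tau * l i))
                    (diag_mx_cexpi_unitary (fun j => tau * m j))).
congr N; apply/matrixP => i j.
by rewrite mul_mx_diag mul_diag_mx !mxE mulrDr cexpiD mulrAC.
Qed.

Lemma posdefmx_spectral_diag (R : realType) (n : nat) (A : 'M[R[i]]_n) i :
  posdefmx A -> 0 < spectral_diag A 0 i.
Proof.
move=> [hA pA]; set P := spectralmx A.
have uP : P \is unitarymx := spectral_unitarymx A.
have PP : P *m P^t* = 1%:M by apply/unitarymxP.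
have AE : A = P^t* *m diag_mx (spectral_diag A) *m P.
  by rewrite -invmx_unitary//; apply/orthomx_spectralP/hermitian_normalmx.
have rP : row i P *m P^t* = row i 1%:M by rewrite -row_mul PP.
have := pA ((row i P)^t*).
have -> : ((row i P)^t*)^t* *m A *m (row i P)^t*
    = row i (diag_mx (spectral_diag A)) *m (row i 1%:M)^t*.
  rewrite trmxCK {1}AE !mulmxA rP -row_mul mul1mx -mulmxA.
  by congr (_ *m _); rewrite -rP adjmxM trmxCK.
have -> : (row i (diag_mx (spectral_diag A)) *m (row i 1%:M)^t*) 0 0
    = spectral_diag A 0 i.
  rewrite mxE (bigD1 i)//= big1 ?addr0 => [|j ji]; rewrite !mxE ?eqxx ?mulr1n.
    by rewrite rmorph1 mulr1.
  by rewrite eq_sym (negPf ji) mulr0n mul0r.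
apply; apply/eqP => /(congr1 (fun M => M^t*)); rewrite trmxCK => r0.
have /matrixP/(_ 0 i) : row i 1%:M = 0 :> 'rV[R[i]]_n.
  by rewrite -rP r0 trmx0 map_mx0 mul0mx.
by rewrite !mxE eqxx => /eqP; rewrite oner_eq0.
Qed.

Lemma mxpowR_diag (R : realType) (n : nat) (A : 'M[R[i]]_n) : posdefmx A ->
  exists (P : 'M[R[i]]_n) (l : 'I_n -> R), P \is unitarymx /\
    forall t, mxpowR A t
      = P^t* *m diag_mx (\row_i real_complex R (expR (t * l i))) *m P.
Proof.
move=> hA; exists (spectralmx A), (fun i => ln (complex.Re (spectral_diag A 0 i))).
split=> [|t]; first exact: spectral_unitarymx.
rewrite /mxpowR; set D := map_mx _ _; rewrite (invmx_unitary (spectral_unitarymx A)).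
set E := \row_i _; suff -> : D = E by reflexivity.
apply/rowP => i; rewrite !mxE.
have := posdefmx_spectral_diag i hA; rewrite ltcE => /andP[_ d0].
by rewrite /powR gt_eqF.
Qed.

Lemma mxpowR1 (R : realType) (n : nat) (A : 'M[R[i]]_n) : posdefmx A -> mxpowR A 1 = A.
Proof.
move=> hA; have nA : A \is normalmx by apply: hermitian_normalmx; case: hA.
rewrite /mxpowR; set D := map_mx _ _; have -> : D = spectral_diag A.
  apply/rowP => i; rewrite mxE.
  have d0 := posdefmx_spectral_diag i hA.
  rewrite powRr1 ?RRe_real ?gtr0_real//.
  by move: d0; rewrite ltcE => /andP[_ /ltW].
symmetry; exact: (orthomx_spectralP nA).
Qed.

Lemma mxpowR0 (R : realType) (n : nat) (A : 'M[R[i]]_n) : mxpowR A 0 = 1%:M.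
Proof.
rewrite /mxpowR; set D := map_mx _ _.
have -> : D = const_mx 1 by apply/rowP => i; rewrite !mxE powRr0.
by rewrite diag_const_mx mulmx1 mulVmx// spectral_unit.
Qed.

Lemma adj_mxpowR (R : realType) (n : nat) (A : 'M[R[i]]_n) (t : R) :
  posdefmx A -> (mxpowR A t)^t* = mxpowR A t.
Proof.
case/mxpowR_diag=> P [l [_]]; move: (mxpowR A) => F ->; rewrite !adjmxM trmxCK mulmxA; congr (_ *m _ *m _).
rewrite tr_diag_mx map_diag_mx; congr diag_mx; apply/rowP => i.
by rewrite !mxE; exact: conj_real_complex.
Qed.

Lemma mxpowR_sandwich (R : realType) (n : nat) (A : 'M[R[i]]_n) : posdefmx A ->
  exists (P : 'M[R[i]]_n) (l : 'I_n -> R), P \is unitarymx /\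
    forall H s r, mxpowR A s *m H *m mxpowR A r
      = P^t* *m schurmx (fun i j => real_complex R (expR (s * l i + r * l j)))
                  (P *m H *m P^t*) *m P.
Proof.
case/mxpowR_diag=> P [l [uP]]; move: (mxpowR A) => F AE.
exists P, l; split=> [//|H s r]; rewrite (AE s) (AE r); set D := diag_mx _; set E := diag_mx _.
have -> : schurmx (fun i j => real_complex R (expR (s * l i + r * l j)))
            (P *m H *m P^t*) = D *m (P *m H *m P^t*) *m E.
  move: (P *m H *m P^t*) => Z; apply/matrixP => i j.
  by rewrite mul_mx_diag mul_diag_mx !mxE expRD rmorphM mulrAC.
by move: D E (P^t*) {AE} => D E Q; rewrite !mulmxA.
Qed.

Lemma mxRe_sandwich (R : realType) (n : nat) (A B X : 'M[R[i]]_n) (c : R[i]) :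
  A^t* = A -> B^t* = B ->
  mxRe (c *: (A *m X *m B + B *m X *m A))
  = A *m mxRe (c *: X) *m B + B *m mxRe (c *: X) *m A.
Proof.
move=> hA hB; have sandZ M N : c *: (M *m X *m N) = M *m (c *: X) *m N.
  by rewrite -scalemxAr -scalemxAl.
rewrite scalerDr !sandZ /mxRe; move: (c *: X) => Y.
rewrite -!scalemxAr -!scalemxAl -scalerDr; congr (_ *: _).
rewrite adjmxD !adjmxM hA hB !mulmxA !mulmxDr !mulmxDl.
by rewrite [X in _ + X]addrC addrACA.
Qed.

Lemma mxRe_congr (R : realType) (n : nat) (A X : 'M[R[i]]_n) (c : R[i]) :
  A^t* = A -> mxRe (c *: (A *m X *m A)) = A *m mxRe (c *: X) *m A.
Proof.
move=> hA; rewrite scalemxAl scalemxAr /mxRe; move: (c *: X) => Y.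
by rewrite -scalemxAr -scalemxAl !adjmxM hA mulmxA mulmxDr mulmxDl.
Qed.

Lemma gnumradius_ub (R : realType) (n : nat) (N : 'M[R[i]]_n -> R) Y (theta : R) :
  is_mxnorm N -> N (mxRe (cexpi theta *: Y)) <= gnumradius N Y.
Proof.
move=> hN; have [N0 _ NZ ND] := hN.
apply: sup_upper_bound; last by exists theta.
split; first by exists (N (mxRe (cexpi theta *: Y))), theta.
exists (normc (2^-1 : R[i]) * (N Y + N (Y^t*))) => _ [u _ <-].
rewrite /mxRe NZ ler_wpM2l ?normc_nneg// (le_trans (ND _ _))//.
have -> : (cexpi u *: Y)^t* = cexpi (- u) *: Y^t*.
  by apply/matrixP => i j; rewrite !mxE rmorphM/= /cexpi cosN sinN.
by rewrite !NZ !normc_cexpi !mul1r.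
Qed.

Lemma gnumradius_le (R : realType) (n : nat) (N : 'M[R[i]]_n -> R) Y (B : R) :
  (forall theta, N (mxRe (cexpi theta *: Y)) <= B) -> gnumradius N Y <= B.
Proof.
move=> hB; apply: ge_sup; first by exists (N (mxRe (cexpi 0 *: Y))), 0.
by move=> _ [u _ <-].
Qed.

Lemma gnumradius_ge0 (R : realType) (n : nat) (N : 'M[R[i]]_n -> R) Y :
  is_mxnorm N -> 0 <= gnumradius N Y.
Proof.
by move=> hN; apply: le_trans (gnumradius_ub Y 0 hN); case: hN.
Qed.

Lemma mxnorm_mxpowR_interp (R : realType) (n : nat) (N : 'M[R[i]]_n -> R)
    (A H : 'M[R[i]]_n) (t : R) :
  is_mxnorm N -> unitarily_invariant N -> posdefmx A -> 0 <= t <= 1 ->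
  N (mxpowR A t *m H *m mxpowR A t) <= N (A *m H *m A) `^ t * N H `^ (1 - t).
Proof.
move=> hN hNU hA ht; have [P [l [uP]]] := mxpowR_sandwich hA.
have : P^t* \is unitarymx by rewrite trmxC_unitary.
(* Generalizing keeps unification from unfolding the spectral decomposition. *)
move: (mxpowR A) (mxpowR1 hA) (P^t*) => F F1 Q uQ sandwich.
have invN Y : N (Q *m Y *m P) = N Y := hNU Y _ _ uQ uP.
have -> : A *m H *m A = F 1 *m H *m F 1 by rewrite F1.
pose Z := P *m H *m Q; have <- : N Z = N H := hNU H P Q uP uQ.
rewrite (sandwich H t t) (sandwich H 1 1) -/Z [leLHS]invN [X in X `^ t]invN.
have := isometric_kernel_three_lines Z hN (isometric_kernel_add l l hNU) ht.
rewrite (eq_schurmx (g := fun i j => real_complex R (expR (t * l i + t * l j)))).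
  rewrite [X in N X `^ t](eq_schurmx
    (g := fun i j => real_complex R (expR (1 * l i + 1 * l j))))// => i j.
  by rewrite !mul1r.
by move=> i j; rewrite mulrDr.
Qed.

Lemma mxnorm_heinz_mono (R : realType) (n : nat) (N : 'M[R[i]]_n -> R)
    (A H : 'M[R[i]]_n) (s t : R) :
  is_mxnorm N -> unitarily_invariant N -> posdefmx A -> `|s - 1 / 2| <= `|t - 1 / 2| ->
  N (mxpowR A s *m H *m mxpowR A (1 - s) + mxpowR A (1 - s) *m H *m mxpowR A s)
  <= N (mxpowR A t *m H *m mxpowR A (1 - t) + mxpowR A (1 - t) *m H *m mxpowR A t).
Proof.
move=> hN hNU hA hst; have [P [l [uP]]] := mxpowR_sandwich hA.
have : P^t* \is unitarymx by rewrite trmxC_unitary.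
move: (mxpowR A) (P^t*) => F Q uQ sandwich.
have invN Y : N (Q *m Y *m P) = N Y := hNU Y _ _ uQ uP.
pose Z := P *m H *m Q.
pose K := schurmx (fun i j => real_complex R (2 * expR ((l i + l j) / 2))) Z.
have heinz u : N (F u *m H *m F (1 - u) + F (1 - u) *m H *m F u)
    = N (schurmx (fun i j => real_complex R (cosh (`|u - 1 / 2| * (l i + - l j)))) K).
  rewrite (sandwich H u (1 - u)) (sandwich H (1 - u) u) -mulmxDl -mulmxDr [LHS]invN; congr N.
  apply/matrixP => i j; rewrite !mxE -mulrDl mulrA -rmorphD -rmorphM.
  congr (real_complex R _ * _).
  rewrite -cosh_norm normrM normr_id -normrM cosh_norm /cosh.
  rewrite mulrA [_ / 2 * 2]divfK ?pnatr_eq0// [RHS]mulrDl -!expRD.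
  by congr (expR _ + expR _); field.
rewrite !heinz; apply: isometric_kernel_mono_cosh => //.
  exact: isometric_kernel_add.
by rewrite normr_ge0.
Qed.

Lemma gnumradius_heinz_mono (R : realType) (n : nat) (N : 'M[R[i]]_n -> R)
    (A X : 'M[R[i]]_n) (s t : R) :
  is_mxnorm N -> unitarily_invariant N -> posdefmx A -> `|s - 1 / 2| <= `|t - 1 / 2| ->
  gnumradius N (mxpowR A s *m X *m mxpowR A (1 - s) + mxpowR A (1 - s) *m X *m mxpowR A s)
  <= gnumradius N (mxpowR A t *m X *m mxpowR A (1 - t) + mxpowR A (1 - t) *m X *m mxpowR A t).
Proof.
move=> hN hNU hA hst; have adjA u := adj_mxpowR u hA.
have heinz H := mxnorm_heinz_mono H hN hNU hA hst.
move: (mxpowR A) adjA heinz => F adjF heinz; apply: gnumradius_le => theta.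
apply: le_trans (gnumradius_ub _ theta hN).
by rewrite (mxRe_sandwich _ _ (adjF s) (adjF _)) (mxRe_sandwich _ _ (adjF t) (adjF _)).
Qed.

Lemma gnumradius_double (R : realType) (n : nat) (N : 'M[R[i]]_n -> R) Y :
  is_mxnorm N -> 2 * gnumradius N Y <= gnumradius N (Y + Y).
Proof.
move=> hN; have [_ _ NZ _] := hN; rewrite mulrC -ler_pdivlMr//.
apply: gnumradius_le => theta; rewrite ler_pdivlMr//.
apply: le_trans (gnumradius_ub _ theta hN).
rewrite scalerDr; have -> (Z : 'M[R[i]]_n) : mxRe (Z + Z) = real_complex R 2 *: mxRe Z.
  by rewrite rmorph_nat scaler_nat mulr2n /mxRe -scalerDr adjmxD addrACA.
by rewrite NZ normc_ger0 ?ler0n// mulrC.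
Qed.

Theorem lemma2p1 (R : realType) (n : nat) (N : 'M[R[i]]_n -> R)
    (hN : is_mxnorm N) (hNU : unitarily_invariant N)
    (A X : 'M[R[i]]_n) (hA : posdefmx A) (t : R) (ht : 0 <= t <= 1) :
  gnumradius N (mxpowR A t *m X *m mxpowR A t)
    <= gnumradius N (A *m X *m A) `^ t * gnumradius N X `^ (1 - t)
  /\ 2 * gnumradius N (mxpowR A (1 / 2) *m X *m mxpowR A (1 / 2))
       <= gnumradius N (mxpowR A t *m X *m mxpowR A (1 - t)
                        + mxpowR A (1 - t) *m X *m mxpowR A t)
       <= gnumradius N (A *m X + X *m A).
Proof.
have h1 : 1 - 1 / 2 = 1 / 2 :> R by lra.
split; last apply/andP; last split.
- apply: gnumradius_le => theta.
  have -> : mxRe (cexpi theta *: (mxpowR A t *m X *m mxpowR A t))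
      = mxpowR A t *m mxRe (cexpi theta *: X) *m mxpowR A t.
    exact: mxRe_congr (adj_mxpowR _ hA).
  apply: le_trans (mxnorm_mxpowR_interp _ hN hNU hA ht) _.
  have -> : A *m mxRe (cexpi theta *: X) *m A = mxRe (cexpi theta *: (A *m X *m A)).
    by rewrite mxRe_congr// -(mxpowR1 hA) adj_mxpowR.
  have [N0 _ _ _] := hN; have /andP[t0 t1] := ht.
  by rewrite ler_pM ?powR_ge0// ge0_ler_powR ?nnegrE ?subr_ge0 ?gnumradius_ge0 ?gnumradius_ub.
- apply: le_trans (gnumradius_double _ hN) _.
  have := @gnumradius_heinz_mono R n N A X (1 / 2) t hN hNU hA.
  by rewrite h1 subrr normr0; apply.
- have := @gnumradius_heinz_mono R n N A X t 1 hN hNU hA.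
  rewrite subrr mxpowR0 (mxpowR1 hA) mulmx1 mul1mx; apply.
  by rewrite h1 [leRHS]ger0_norm// ler_norml; lra.
Qed.
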